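(* Let $1\leq p<\infty$ and let $K\subset[0,1]$ be a meager $F_\sigma$ set. Then there is a continuous mapping $f:[0,1]\to\mathcal{L}^p(\Omega)$, $t\mapsto f_t$, satisfying (i) $f_t$ is absolutely continuous for all $t\in[0,1]$, (ii) $f_t\in C^\infty(\Omega)$ for every $t\in K$, but also (A) for every $t\in K$ there exists a sequence $(t_n)_{n\in\mathbb{N}}$ in $[0,1]$ with $\lim_{n\to\infty}t_n=t$ such that $$\lambda\big(\{x\in\Omega:\ (f_{t_n}(x))_{n\in\mathbb{N}}\text{ is Cauchy}\}\big)=0.$$ In particular, if $\mu(K)=1$, then the conditions in (ii) and (A) hold for $\mu$-a.e. $t\in[0,1]$.
   Context: $\Omega=[0,1]$ is the space domain, with Borel $\sigma$-field and Lebesgue measure, denoted $\lambda$. The index set is the unit interval $[0,1]$ with its usual norm, Borel $\sigma$-field and Lebesgue measure, denoted $\mu$. $\mathcal{L}^p(\Omega)$ is the space of real-valued $p$-integrable functions on $\Omega$, where almost everywhere equal functions are NOT identified, equipped with the topology induced by the seminorm $\|\cdot\|_p$; continuity of $f:[0,1]\to\mathcal{L}^p(\Omega)$ is with respect to this topology. For each $t$, $f_t$ is thus an actual function $\Omega\to\mathbb{R}$, and (i), (ii), (A) refer to this function. $C^\infty(\Omega)$ denotes the space of real-valued smooth functions on $\Omega\setminus\partial\Omega$. *)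

(* Defs.v *)
From HB Require Import structures.
From mathcomp Require Import all_boot all_order all_algebra.
From mathcomp Require Import all_classical all_reals all_analysis.

Set Implicit Arguments.
Unset Strict Implicit.
Unset Printing Implicit Defensive.

Import Order.TTheory GRing.Theory Num.Theory.
Import numFieldNormedType.Exports.

Local Open Scope classical_set_scope.
Local Open Scope ring_scope.

Definition nowhere_dense (T : topologicalType) (A : set T) : Prop :=
  (closure A)° = set0.

Definition meager (T : topologicalType) (A : set T) : Prop :=
  exists2 F : (set T)^nat,
    (forall n, nowhere_dense (F n)) & A = \bigcup_n F n.

(* The intervals of the family are disjoint as open intervals; they may share
   endpoints or be degenerate. *)
Definition abs_continuous (R : realType) (a b : R) (f : R -> R) : Prop :=
  forall e : R, 0 < e -> exists2 d : R, 0 < d &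
    forall (n : nat) (u v : 'I_n -> R),
      (forall i, a <= u i /\ u i <= v i /\ v i <= b) ->
      trivIset setT (fun i => `]u i, v i[%classic) ->
      \sum_(i < n) (v i - u i) < d ->
      \sum_(i < n) `|f (v i) - f (u i)| < e.

Definition smooth_on (R : realType) (U : set R) (f : R -> R) : Prop :=
  forall (n : nat) (x : R), U x -> derivable (derive1n n f) x 1.

(* Functions on [0,1] are represented by functions on R, considered through the
   restriction of Lebesgue measure to [0,1]. *)
Definition lebesgue01 (R : realType) :
    {measure set (measurableTypeR R) -> \bar R} :=
  mrestr (@lebesgue_measure R) (measurable_itv `[0%R, 1%R]).

(* LfunType carries no topology in the library. As functions that agree almost
   everywhere are not identified, the pseudometric below is not separated. *)
Definition calLp d (T : measurableType d) (R : realType)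
    (mu : {measure set T -> \bar R}) (p : \bar R) (p1 : (1 <= p)%E) : Type :=
  LfunType mu p1.

Section calLp_pseudometric.
Context d (T : measurableType d) (R : realType).
Variables (mu : {measure set T -> \bar R}) (p : \bar R) (p1 : (1 <= p)%E).

Local Notation L := (calLp mu p1).

HB.instance Definition _ := GRing.Zmodule.copy L (LfunType mu p1).

Definition Lp_seminorm (f : L) : R :=
  fine ('N[mu]_p[EFin \o (f : LfunType mu p1)])%E.

Definition Lp_ball : L -> R -> set L := ball_ Lp_seminorm.

Definition Lp_ent : set_system (L * L) := entourage_ Lp_ball.

Definition Lp_nbhs (f : L) : set_system L := nbhs_ Lp_ent f.

HB.instance Definition _ := hasNbhs.Build L Lp_nbhs.

Let Lp_nbhsE : Lp_nbhs = nbhs_ Lp_ent. Proof. by []. Qed.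

Let Lp_entE : Lp_ent = entourage_ Lp_ball. Proof. by []. Qed.

Let Lp_ball_center f (e : R) : 0 < e -> Lp_ball f e f.
Proof.
move=> e0; rewrite /Lp_ball /ball_/= subrr /Lp_seminorm.
rewrite (_ : _ \o _ = cst 0%E); last by apply/funext.
by rewrite Lnorm0// gt_eqF// (lt_le_trans _ p1).
Qed.

Let Lp_ball_sym f g (e : R) : Lp_ball f e g -> Lp_ball g e f.
Proof.
rewrite /Lp_ball /ball_/= -(opprB g f).
by rewrite [X in X < _ -> _](LnormrN (g - f : LfunType mu p1)).
Qed.

Let Lp_ball_triangle f g h (e1 e2 : R) :
  Lp_ball f e1 g -> Lp_ball g e2 h -> Lp_ball f (e1 + e2) h.
Proof.
rewrite /Lp_ball /ball_/= => fg gh.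
rewrite -(subrKA g); apply: le_lt_trans (ltrD fg gh).
exact: ler_LnormD.
Qed.

HB.instance Definition _ := @Nbhs_isPseudoMetric.Build R L
  Lp_ent Lp_nbhsE Lp_ball Lp_ball_center Lp_ball_sym Lp_ball_triangle Lp_entE.

End calLp_pseudometric.

Identity Coercion calLp_LfunType : calLp >-> Lfunction.type.

(* Main.v *)
Require Import Defs.
From HB Require Import structures.
From mathcomp Require Import all_boot all_order all_algebra.
From mathcomp Require Import all_classical all_reals all_analysis.
From mathcomp Require Import borel_hierarchy.
From mathcomp Require Import measurable_realfun ring lra.

Import Order.TTheory GRing.Theory Num.Theory.
Import numFieldNormedType.Exports.

Local Open Scope classical_set_scope.
Local Open Scope ring_scope.

Set Implicit Arguments.
Unset Strict Implicit.
Unset Printing Implicit Defensive.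

(** Moving bumps that sweep over [[0, 1]] while they get narrower tend to 0 in
    every [L^p] and converge at no point.  This is used with a time that
    depends on the distance to a closed set.

    For one closed set [E] with no interior in [[0, 1]], let [y] be the inverse
    of the distance from [t] to [E], and let [f_t] be the [n]-th bump of the
    sweep for [y = n + 1 / 2], with an amplitude that interpolates and vanishes
    at the integers; for [t] in [E] let [f_t = 0].  Off [E] the function [f_t]
    depends continuously on [t] in the uniform norm, and near [E] it is a narrow
    bump, so that [t |-> f_t] is continuous in [L^p].  Any point of [E] is a
    limit of points off [E], near which the distance takes all small positive
    values: hence some sequence [t_n] tends to this point with [f_(t_n)] equal to
    the [n]-th bump for all large [n] ([set_dist_sequence]).

    A meager [F_sigma] set [K] is the union of an increasing sequence of closed
    sets [E k] which, by the theorem of Baire, have no interior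
    ([fsigma_exhaustion]), and [f_t] is the sum over [k] of the functions built
    from the [E k] with the weights [8 ^ - (k + 1)].
    - If [t] lies in [E M] then the terms from the [M]-th on vanish at [t].  As
      the bumps are polynomials, [f_t] is a polynomial on [[0, 1]].
    - For any [t], finitely many terms are Lipschitz, and each remaining term
      has total variation at most twice its weight, because a bump increases
      and then decreases: so [f_t] is absolutely continuous
      ([superposition_abs_continuous]), although the Lipschitz constants of its
      terms need not be summable.
    - Let [k] be minimal with [t] in [E k], and let [t_n] be as above for [E k].
      The terms before the [k]-th converge at [t_n], the [k]-th one oscillates
      by at least half of its weight, and the sum of the later ones is at most
      a seventh of this weight: the values of [f_(t_n)] form a Cauchy sequence
      at no point of [[0, 1]] ([superposition_not_cauchy]).

    Continuity in [L^p] comes from convergence in measure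
    ([superposition_cvg_in_measure]), all the functions being bounded. *)

(** * Polynomial bumps sweeping over the unit interval *)

Section typewriter.
Context {R : realType}.
Implicit Types (n m : nat) (x y : R).

(** The [2 ^ m] indices [n] from [2 ^ m] on have the centers [j / 2 ^ m]. *)
Definition center n : R :=
  (n - 2 ^ trunc_log 2 n)%:R / 2 ^+ trunc_log 2 n.

(** The exponent [n] makes the bumps with indices near [2 ^ m] narrow, but
    wider than the distance [1 / 2 ^ m] of their centers. *)
Definition bump n : {poly R} := (1 - ('X - (center n)%:P) ^+ 2) ^+ n.

Lemma bumpE n x : (bump n).[x] = (1 - (x - center n) ^+ 2) ^+ n.
Proof. by rewrite /bump horner_exp !hornerE. Qed.

Lemma center_block m j : (j < 2 ^ m)%N ->
  center (2 ^ m + j) = j%:R / 2 ^+ m.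
Proof.
move=> jm; rewrite /center (@trunc_log_eq 2 m) ?addKn//.
by rewrite leq_addr/= expnS mul2n -addnn ltn_add2l.
Qed.

Lemma center_ge0 n : 0 <= center n.
Proof. by rewrite divr_ge0// exprn_ge0. Qed.

Lemma center_le1 n : center n <= 1.
Proof.
rewrite /center ler_pdivrMr ?exprn_gt0// mul1r -natrX ler_nat.
have [->//|n0] := posnP n; rewrite leq_subLR addnn -mul2n -expnS ltnW//.
exact: trunc_log_ltn.
Qed.

Lemma bump_base01 n x : 0 <= x <= 1 -> 0 <= 1 - (x - center n) ^+ 2 <= 1.
Proof.
have := center_ge0 n; have := center_le1 n => c1 c0 /andP[x0 x1].
rewrite subr_ge0 lerBlDl lerDr sqr_ge0 andbT -real_normK ?num_real//.
rewrite expr_le1// ler_norml; apply/andP; split; lra.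
Qed.

Lemma bump01 n x : 0 <= x <= 1 -> 0 <= (bump n).[x] <= 1.
Proof.
by move=> /(bump_base01 n)/andP[b0 b1]; rewrite bumpE exprn_ge0//= exprn_ile1.
Qed.

Lemma bernoulli n x : 0 <= x <= 1 -> 1 - n%:R * x <= (1 - x) ^+ n.
Proof.
move=> /andP[x0 x1]; elim: n => [|n IH]; first by rewrite mul0r subr0 expr0.
rewrite exprS (le_trans _ (ler_wpM2l _ IH)) ?subr_ge0//.
have n0 : 0 <= n%:R :> R by [].
by rewrite -natr1; nra.
Qed.

(** Among the centers [j / 2 ^ m] one is at distance at most [1 / 2 ^ m] of [x],
    and there the inequality of Bernoulli bounds the bump from below by
    [1 - 2 ^ (m + 1) / 4 ^ m]. *)
Lemma bump_high N x : 0 <= x <= 1 ->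
  exists2 n, (N <= n)%N & 3 / 4 <= (bump n).[x].
Proof.
move=> /andP[x0 x1].
pose m := (N + 4)%N.
have pm : 0 < 2 ^+ m :> R by exact: exprn_gt0.
have pmN : 2 ^+ m != 0 :> R by rewrite gt_eqF.
have [j jm jx] : exists2 j, (j < 2 ^ m)%N & `|x - j%:R / 2 ^+ m| <= (2 ^+ m)^-1.
  have := truncn_itv (mulr_ge0 x0 (ltW pm)).
  set j := Num.truncn _ => /andP[jx xj].
  have [jm|mj] := ltnP j (2 ^ m).
    exists j => //; rewrite -[x in x - _](mulfK pmN) -mulrBl normrM.
    rewrite (@ger0_norm _ (_^-1)) ?invr_ge0 ?(ltW pm)// ler_piMl ?invr_ge0 ?(ltW pm)//.
    by rewrite ger0_norm ?subr_ge0// lerBlDl natr1 ltW.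
  (* The last center is [1 - 1 / 2 ^ m]: the point 1 falls beyond the grid. *)
  exists (2 ^ m).-1; first by rewrite prednK ?expn_gt0.
  have x1' : 1 <= x.
    rewrite -(ler_pM2r pm) mul1r (le_trans _ jx)// -natrX ler_nat//.
  have -> : x = 1 by apply/eqP; rewrite eq_le x1.
  have -> : ((2 ^ m).-1)%:R = 2 ^+ m - 1 :> R.
    by rewrite -natrX -[in RHS](@prednK (2 ^ m)) ?expn_gt0// -natr1 addrK.
  by rewrite mulrBl divff// mul1r opprB subrKC ger0_norm ?invr_ge0 ?(ltW pm)//.
exists (2 ^ m + j)%N.
  rewrite (leq_trans _ (leq_addr _ _))// (leq_trans _ (ltnW (ltn_expl _ _)))//.
  exact: leq_addr.
rewrite bumpE center_block//; set u := x - _ in jx *.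
have p4 : 16 <= 2 ^+ m :> R.
  rewrite -natrX ler_nat (@leq_pexp2l 2 4)// /m leq_addl//.
have u2 : u ^+ 2 <= (2 ^+ m)^-1 ^+ 2.
  by rewrite -[u ^+ 2]real_normK ?num_real// lerXn2r// nnegrE ?invr_ge0 ?(ltW pm)//.
have i16 : (2 ^+ m)^-1 <= 16^-1 :> R by rewrite lef_pV2// posrE.
have i0 : 0 < (2 ^+ m)^-1 :> R by rewrite invr_gt0.
apply: le_trans (bernoulli _ _); last by rewrite sqr_ge0/=; nra.
have nm : (2 ^ m + j)%:R <= 2 * 2 ^+ m :> R.
  by rewrite -natrX -natrM ler_nat mul2n -addnn leq_add2l ltnW.
have : (2 ^ m + j)%:R * u ^+ 2 <= 2 * 2 ^+ m * (2 ^+ m)^-1 ^+ 2.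
  by rewrite ler_pM// sqr_ge0.
rewrite [in leRHS]expr2 [leRHS]mulrA mulfK//; lra.
Qed.

Lemma bump_le_off n x eta : 0 <= x <= 1 -> 0 <= eta -> eta <= `|x - center n| ->
  (bump n).[x] <= (1 - eta ^+ 2) ^+ n.
Proof.
move=> x01 eta0 etax; rewrite bumpE.
have /andP[b0 b1] := bump_base01 n x01.
have e2 : eta ^+ 2 <= (x - center n) ^+ 2.
  by rewrite -[leRHS]real_normK ?num_real// lerXn2r// nnegrE.
by rewrite lerXn2r// ?nnegrE; lra.
Qed.

Lemma expr_small (q e : R) : 0 <= q < 1 -> 0 < e ->
  exists N, forall n, (N <= n)%N -> q ^+ n <= e.
Proof.
move=> /andP[q0 q1] e0.
have : q ^+ n @[n --> \oo] --> (0 : R) by apply: cvg_expr; rewrite ger0_norm.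
move=> /cvgrPdist_le/(_ _ e0)[N _ HN]; exists N => n /HN.
by rewrite sub0r normrN; apply: le_trans; exact: ler_norm.
Qed.

(** One of the two centers 0 and [1 / 2] is at distance at least [1 / 4]. *)
Lemma bump_low N x : 0 <= x <= 1 ->
  exists2 n, (N <= n)%N & (bump n).[x] <= 1 / 4.
Proof.
move=> x01;
  have [N0 HN0] := @expr_small (1 - (1 / 4) ^+ 2) (1 / 4) ltac:(lra) ltac:(lra).
pose m := (N + N0).+1.
have Nm j : (N + N0 <= 2 ^ m + j)%N.
  by rewrite (leq_trans _ (leq_addr _ _))// (leq_trans _ (ltnW (ltn_expl _ _))).
have [j jm jx] : exists2 j, (j < 2 ^ m)%N & 1 / 4 <= `|x - j%:R / 2 ^+ m|.
  have [x4|x4] := leP (1 / 4) x.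
    exists 0%N; first by rewrite expn_gt0.
    by rewrite mul0r subr0 (le_trans x4)// ler_norm.
  exists (2 ^ (N + N0))%N; first by rewrite ltn_exp2l.
  rewrite natrX exprS invfM mulrCA divff ?mulr1; last first.
    by rewrite gt_eqF ?exprn_gt0.
  by rewrite distrC ler_normr; apply/orP; left; lra.
exists (2 ^ m + j)%N; first exact: leq_trans (leq_addr _ _) (Nm j).
rewrite -(center_block jm) in jx.
rewrite (le_trans (bump_le_off _ _ jx))//.
by rewrite HN0// (leq_trans _ (Nm j))// leq_addl.
Qed.

Lemma bump_lipschitz n x y : 0 <= x <= 1 -> 0 <= y <= 1 ->
  `|(bump n).[x] - (bump n).[y]| <= (2 * n%:R) * `|x - y|.
Proof.
move=> x01 y01; rewrite !bumpE.
have /andP[bx0 bx1] := bump_base01 n x01.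
have /andP[by0 by1] := bump_base01 n y01.
have -> : 2 * n%:R * `|x - y| = n%:R * (2 * `|x - y|) by ring.
have bxy : `|(1 - (x - center n) ^+ 2) - (1 - (y - center n) ^+ 2)| <=
    2 * `|x - y|.
  have -> : (1 - (x - center n) ^+ 2) - (1 - (y - center n) ^+ 2) =
    ((center n - x) + (center n - y)) * (x - y) by ring.
  rewrite normrM ler_wpM2r//.
  have := center_ge0 n; have := center_le1 n => c1 c0.
  rewrite ler_norml; apply/andP; split; lra.
move: bx0 bx1 by0 by1 bxy; set b := 1 - _; set c := 1 - _ => b0 b1 c0 c1 bc.
apply: (@le_trans _ _ (n%:R * `|b - c|)); last by rewrite ler_wpM2l.
elim: n b c b0 b1 c0 c1 {bc} => [|n IH] b c b0 b1 c0 c1.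
  by rewrite !expr0 subrr normr0 mul0r.
have -> : b ^+ n.+1 - c ^+ n.+1 = b * (b ^+ n - c ^+ n) + (b - c) * c ^+ n.
  by rewrite !exprS; ring.
rewrite (le_trans (ler_normD _ _))// !normrM -natr1 mulrDl mul1r.
have cn : `|c ^+ n| <= 1 by rewrite ger0_norm ?exprn_ile1// exprn_ge0.
rewrite (ger0_norm b0) lerD// ?ler_piMr//.
by rewrite (le_trans (ler_piMl _ b1))// IH.
Qed.

Lemma bump_incr n x y : 0 <= x -> x <= y -> y <= center n ->
  (bump n).[x] <= (bump n).[y].
Proof.
move=> x0 xy yc; rewrite !bumpE.
have c1 := center_le1 n.
have /andP[bx0 _] := @bump_base01 n x ltac:(lra).
have /andP[by0 _] := @bump_base01 n y ltac:(lra).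
by rewrite lerXn2r ?nnegrE//; nra.
Qed.

Lemma bump_decr n x y : center n <= x -> x <= y -> y <= 1 ->
  (bump n).[y] <= (bump n).[x].
Proof.
move=> cx xy y1; rewrite !bumpE.
have c0 := center_ge0 n.
have /andP[bx0 _] := @bump_base01 n x ltac:(lra).
have /andP[by0 _] := @bump_base01 n y ltac:(lra).
by rewrite lerXn2r ?nnegrE//; nra.
Qed.

End typewriter.

(** * Pulses and their total variation *)

Section variation.
Context {R : realType}.

(** The open intervals between [h (u i)] and [h (v i)] are disjoint because [h]
    is monotone, so their lengths add up to at most the measure of [[0, 1]]. *)
Lemma incr_variation (h : R -> R) n (u v : 'I_n -> R) :
  {homo h : x y / x <= y} -> (forall x, 0 <= h x <= 1) ->
  (forall i, u i <= v i) ->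
  trivIset setT (fun i => `]u i, v i[%classic) ->
  \sum_(i < n) (h (v i) - h (u i)) <= 1.
Proof.
move=> hh h01 uv tuv.
pose F i : set R := `]h (u i), h (v i)[%classic.
have mF i : measurable (F i) by exact: measurable_itv.
have tF : trivIset setT F.
  move=> i j _ _ [y []]; rewrite /F/= !in_itv/= => /andP[ui vi] /andP[uj vj].
  have vh a b : h (u a) < h (v b) -> u a < v b.
    by move=> ab; rewrite ltNge; apply/negP => /hh; rewrite leNgt ab.
  have ii := vh _ _ (lt_trans ui vi); have jj := vh _ _ (lt_trans uj vj).
  have ij := vh _ _ (lt_trans ui vj); have ji := vh _ _ (lt_trans uj vi).
  apply: tuv => //.
  exists ((Num.max (u i) (u j) + Num.min (v i) (v j)) / 2); split => /=;
    rewrite in_itv/=; case: (ltP (u i) (u j)) => ?;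
      case: (ltP (v i) (v j)) => ?; lra.
have : (lebesgue_measure (\big[setU/set0]_(i < n) F i) <=
    @lebesgue_measure R `[0%R, 1%R])%E.
  apply: le_measure; rewrite ?inE//.
    apply: bigsetU_measurable => i _; exact: mF.
  rewrite -bigcup_seq => y [i _]; rewrite /F/= !in_itv/= => /andP[uy yv].
  by have /andP[? _] := h01 (u i); have /andP[_ ?] := h01 (v i); lra.
rewrite measure_bigsetU_ord// lebesgue_measure_itv/= lte_fin ltr01 oppr0 adde0.
rewrite (eq_bigr (fun i => (h (v i) - h (u i))%:E)) ?sumEFin ?lee_fin// => i _.
rewrite /F lebesgue_measure_itv/= lte_fin -EFinD; case: ltP => // vu.
have := hh _ _ (uv i); move=> uv'.
by congr EFin; apply/esym/eqP; rewrite subr_eq0 eq_le vu.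
Qed.

(** Clamping makes the bumps bounded and monotone on both sides of their center
    on the whole line, without changing them on [[0, 1]]. *)
Definition clamp (x : R) : R := Num.max 0 (Num.min 1 x).

Lemma clamp01 x : 0 <= clamp x <= 1.
Proof. by rewrite /clamp le_max lexx ge_max ler01 ge_min lexx. Qed.

Lemma clamp_id x : 0 <= x <= 1 -> clamp x = x.
Proof. by move=> /andP[x0 x1]; rewrite /clamp min_r// max_r. Qed.

Lemma clamp_homo : {homo clamp : x y / x <= y}.
Proof.
move=> x y xy; rewrite /clamp ge_max le_max lexx/= le_max.
by apply/orP; right; rewrite le_min !ge_min lexx xy orbT.
Qed.

Lemma continuous_clamp : continuous clamp.
Proof.
move=> x; apply: continuous_max; first exact: cvg_cst.
by apply: continuous_min; [exact: cvg_cst|exact: cvg_id].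
Qed.

Definition pulse n x := (bump n).[clamp x].

Lemma pulse01 n x : 0 <= pulse n x <= 1.
Proof. by apply: bump01; exact: clamp01. Qed.

Lemma continuous_pulse n : continuous (pulse n).
Proof.
move=> x; apply: (@continuous_comp _ _ _ clamp (horner (bump n))).
  exact: continuous_clamp.
exact: continuous_horner.
Qed.

Lemma pulse_lipschitz n x y : 0 <= x <= 1 -> 0 <= y <= 1 ->
  `|pulse n x - pulse n y| <= 2 * n%:R * `|x - y|.
Proof. by move=> x01 y01; rewrite /pulse !clamp_id// bump_lipschitz. Qed.

(** Up to a constant, a pulse is the difference of two nondecreasing functions
    with values in [[0, 1]]: its increasing half and the complement to 1 of its
    decreasing half. *)
Lemma pulse_variation m n (u v : 'I_n -> R) :
  (forall i, u i <= v i) ->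
  trivIset setT (fun i => `]u i, v i[%classic) ->
  \sum_(i < n) `|pulse m (v i) - pulse m (u i)| <= 2.
Proof.
move=> uv tuv; set c := center m : R.
pose g x := (bump m).[Num.min c (clamp x)].
pose h x := 1 - (bump m).[Num.max c (clamp x)].
have c0 : 0 <= c by exact: center_ge0.
have c1 : c <= 1 by exact: center_le1.
have minc x : 0 <= Num.min c (clamp x) <= 1.
  have /andP[x0 x1] := clamp01 x; rewrite le_min c0 x0 ge_min c1//.
have maxc x : 0 <= Num.max c (clamp x) <= 1.
  have /andP[x0 x1] := clamp01 x; rewrite le_max c0 ge_max c1 x1//.
have gh : {homo g : x y / x <= y}.
  move=> x y /clamp_homo xy; apply: bump_incr; last by rewrite ge_min lexx.
    by have /andP[] := minc x.
  by rewrite le_min !ge_min lexx xy !orbT.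
have hh : {homo h : x y / x <= y}.
  move=> x y /clamp_homo xy; rewrite lerD2l lerN2.
  apply: bump_decr; first by rewrite le_max lexx.
    by move: (clamp x) (clamp y) xy => a b ab;
      rewrite ge_max !le_max lexx ab !orbT.
  by have /andP[] := maxc y.
have g01 x : 0 <= g x <= 1 by exact: bump01.
have h01 x : 0 <= h x <= 1.
  by rewrite subr_ge0 gerBl andbC; apply: bump01.
have pE x : pulse m x = g x - h x + (1 - (bump m).[c]).
  rewrite /pulse /g /h; case: (leP c (clamp x)) => _; lra.
apply: (@le_trans _ _ (\sum_(i < n) (g (v i) - g (u i)) +
    \sum_(i < n) (h (v i) - h (u i)))); last first.
  by apply: (@le_trans _ _ (1 + 1)); rewrite ?lerD//; exact: incr_variation.
rewrite -big_split/= ler_sum// => i _; rewrite !pE.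
have := gh _ _ (uv i); have := hh _ _ (uv i) => ? ?.
rewrite ler_norml; apply/andP; split; lra.
Qed.

(** A parabola on each interval between consecutive integers: it vanishes at the
    integers, where the pulse changes, and is 1 at the half-integers. *)
Definition amplitude (y : R) : R :=
  4 * (y - (Num.truncn y)%:R) * (1 - (y - (Num.truncn y)%:R)).

Definition wave (y x : R) : R := amplitude y * pulse (Num.truncn y) x.

Lemma amplitude01 y : 0 <= y -> 0 <= amplitude y <= 1.
Proof.
move=> /truncn_itv/andP[]; rewrite -natr1 /amplitude => ny yn.
have := sqr_ge0 (2 * (y - (Num.truncn y)%:R) - 1) => sq.
by apply/andP; split; nra.
Qed.

Lemma wave01 y x : 0 <= y -> 0 <= wave y x <= 1.
Proof.
move=> /amplitude01/andP[a0 a1]; rewrite /wave.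
have /andP[p0 p1] := pulse01 (Num.truncn y) x.
by rewrite mulr_ge0//= mulr_ile1.
Qed.

Lemma wave0 x : wave 0 x = 0.
Proof. by rewrite /wave /amplitude truncn0 subrr mulr0 !mul0r. Qed.

Lemma wave_half n x : wave (n%:R + 2^-1) x = pulse n x.
Proof.
rewrite /wave /amplitude (_ : Num.truncn _ = n); last first.
  by apply/eqP; rewrite truncn_eq -?(natr1 n);
    [apply/andP; split; lra|apply: addr_ge0].
by rewrite -[RHS]mul1r; congr (_ * _); lra.
Qed.

(** If an integer separates [y] from [z], then both amplitudes are bounded by
    four times the distance to this integer. *)
Lemma wave_lipschitz y z x : 0 <= y -> 0 <= z ->
  `|wave y x - wave z x| <= 4 * `|y - z|.
Proof.
wlog yz : y z / y <= z => [H y0 z0|y0 z0].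
  have [yz|zy] := leP y z; first exact: H.
  by rewrite distrC [X in _ * X]distrC H// ltW.
rewrite (distrC y) (ger0_norm (x := z - y)) ?subr_ge0//.
have /andP[] := truncn_itv y0; have /andP[] := truncn_itv z0.
have := @le_truncn R y z yz.
rewrite /wave /amplitude; move: (Num.truncn y) (Num.truncn z) => m n.
rewrite -(natr1 m) -(natr1 n) leq_eqVlt => /predU1P[<-|mn] nz zn my yn.
  have /andP[p0 p1] := pulse01 m x.
  rewrite -mulrBl normrM (ger0_norm p0).
  apply: le_trans (ler_piMr _ p1) _ => //.
  by rewrite ler_norml; apply/andP; split; nra.
have mn' : m%:R + 1 <= n%:R :> R by rewrite natr1 ler_nat.
have /andP[p0 p1] := pulse01 m x; have /andP[q0 q1] := pulse01 n x.
have A : 0 <= 4 * (y - m%:R) * (1 - (y - m%:R)) <= 4 * (m%:R + 1 - y).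
  have := sqr_ge0 (m%:R + 1 - y) => sq.
  by apply/andP; split; nra.
have B : 0 <= 4 * (z - n%:R) * (1 - (z - n%:R)) <= 4 * (z - n%:R).
  have := sqr_ge0 (z - n%:R) => sq.
  by apply/andP; split; nra.
move: A B; set a := _ * (1 - _); set b := _ * (1 - _) => A B.
have A' : 0 <= a * pulse m x <= a.
  by case/andP: A => a0 _; rewrite mulr_ge0 ?ler_piMr.
have B' : 0 <= b * pulse n x <= b.
  by case/andP: B => b0 _; rewrite mulr_ge0 ?ler_piMr.
by rewrite ler_norml; apply/andP; split; lra.
Qed.

Lemma wave_space_lipschitz y u v : 0 <= y -> 0 <= u <= 1 -> 0 <= v <= 1 ->
  `|wave y v - wave y u| <= 2 * (Num.truncn y)%:R * `|v - u|.
Proof.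
move=> /amplitude01/andP[a0 a1] u01 v01.
rewrite /wave -mulrBr normrM (ger0_norm a0).
by rewrite (le_trans (ler_piMl _ a1))// pulse_lipschitz.
Qed.

Lemma wave_variation y n (u v : 'I_n -> R) : 0 <= y ->
  (forall i, u i <= v i) ->
  trivIset setT (fun i => `]u i, v i[%classic) ->
  \sum_(i < n) `|wave y (v i) - wave y (u i)| <= 2.
Proof.
move=> /amplitude01/andP[a0 a1] uv tuv.
apply: le_trans (pulse_variation (Num.truncn y) uv tuv).
apply: ler_sum => i _; rewrite /wave -mulrBr normrM (ger0_norm a0).
exact: ler_piMl.
Qed.

(** For large [y] the wave is small off a short interval, which moves with
    [y]. *)
Lemma wave_small (eta : R) : 0 < eta <= 1 -> exists Y : R,
  forall y, Y <= y -> 0 <= y -> exists c : R, forall x, 0 <= x <= 1 ->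
    ~ `]c - eta, c + eta[%classic x -> wave y x <= eta.
Proof.
move=> /[dup] /andP[eta0 _] eta01.
have [N HN] := @expr_small R (1 - eta ^+ 2) eta ltac:(nra) eta0.
exists N%:R => y Ny y0; exists (center (Num.truncn y)) => x x01 xc.
have /andP[a0 a1] := amplitude01 y0; rewrite /wave.
rewrite (le_trans (ler_piMl _ a1))//;
  first by have /andP[] := pulse01 (Num.truncn y) x.
rewrite /pulse clamp_id// (le_trans (bump_le_off _ (ltW eta0) _))//.
  by rewrite leNgt; apply/negP => xc'; apply: xc;
    rewrite /= in_itv/= -ltr_distl.
by apply: HN; rewrite -[N](@natrK R); exact: le_truncn.
Qed.

End variation.

(** * Series with geometric weights *)

Section weighted_series.
Context {R : realType}.
Implicit Types (w : R^nat) (M n : nat).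

Definition weight n : R := 8^-1 ^+ n.+1.

Lemma weight_gt0 n : 0 < weight n.
Proof. by rewrite exprn_gt0. Qed.

Lemma weight_ge0 n : 0 <= weight n.
Proof. exact/ltW/weight_gt0. Qed.

Lemma weight_sum M n :
  \sum_(M <= k < M + n) weight k = (8^-1 ^+ M - 8^-1 ^+ (M + n)) / 7.
Proof.
elim: n => [|n IH]; first by rewrite addn0 big_geq// subrr mul0r.
by rewrite addnS big_nat_recr ?leq_addr//= IH /weight exprS; lra.
Qed.

Definition wsum w : R := limn (series (fun k => weight k * w k)).

Lemma wsum_cvg w : (forall k, `|w k| <= 1) ->
  series (fun k => weight k * w k) @ \oo --> wsum w.
Proof.
move=> w1; apply: normed_cvg.
apply: (@series_le_cvg _ _ (geometric 1 8^-1)) => [n|n|n|].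
- exact: normr_ge0.
- by rewrite /= mul1r exprn_ge0.
- rewrite /= mul1r normrM (ger0_norm (weight_ge0 n)).
  rewrite (le_trans (ler_piMr (weight_ge0 n) (w1 n)))//.
  by rewrite /weight exprS ler_piMl ?exprn_ge0//; lra.
- by apply: is_cvg_geometric_series; rewrite ger0_norm; lra.
Qed.

(** The remainder is dominated by a geometric series.  For [M = k.+1] the bound
    is a seventh of the weight of the [k]-th term. *)
Lemma wsum_approx w M : (forall k, `|w k| <= 1) ->
  `|wsum w - \sum_(0 <= k < M) weight k * w k| <= 8^-1 ^+ M / 7.
Proof.
move=> w1; apply/ler_addgt0Pr => e e0.
have /cvgrPdist_le/(_ _ e0)[N _ HN] := wsum_cvg w1.
have := HN (M + N)%N (leq_addl _ _); rewrite /series/= => HMN.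
rewrite -(subrKA (\sum_(0 <= k < M + N) weight k * w k)).
rewrite (le_trans (ler_normD _ _))// [leRHS]addrC lerD//.
rewrite (@big_cat_nat _ _ _ M)//= ?leq_addr// addrAC subrr add0r.
apply: (@le_trans _ _ (\sum_(M <= k < M + N) weight k)).
  rewrite (le_trans (ler_norm_sum _ _ _))// ler_sum// => k _.
  by rewrite normrM (ger0_norm (weight_ge0 k)) ler_piMr// weight_ge0.
have : 0 <= 8^-1 ^+ (M + N) :> R by rewrite exprn_ge0.
by rewrite weight_sum; lra.
Qed.

End weighted_series.


(** * Distance to a closed set *)

Section set_dist.
Context {R : realType}.
Implicit Types (E : set R) (t u : R).

(** The infimum of the empty set of reals is 0: a closed set at distance 0 of a
    point contains it only if the set is nonempty. *)
Definition set_dist E t : R := inf [set `|t - z| | z in E].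

Let has_lb E t : has_lbound [set `|t - z| | z in E].
Proof. by exists 0 => _ [z _ <-]. Qed.

Lemma set_dist_set0 t : set_dist set0 t = 0.
Proof. by rewrite /set_dist image_set0 inf0. Qed.

Lemma set_dist_ge0 E t : 0 <= set_dist E t.
Proof.
have [->|/set0P[z Ez]] := eqVneq E set0; first by rewrite set_dist_set0.
apply: lb_le_inf; first by exists `|t - z|; exists z.
by move=> _ [? _ <-].
Qed.

Lemma set_dist0 E t : E t -> set_dist E t = 0.
Proof.
move=> Et; apply/eqP; rewrite eq_le set_dist_ge0 andbT.
by apply: ge_inf => //; exists t => //; rewrite subrr normr0.
Qed.

Lemma set_dist_gt0 E t : closed E -> E !=set0 -> ~ E t -> 0 < set_dist E t.
Proof.
move=> cE [z Ez] Et; have : nbhs t (~` E) by apply: open_nbhs_nbhs;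
  split => //; rewrite openC.
move=> /nbhs_ballP[e /= e0 eE]; apply: (lt_le_trans e0).
apply: lb_le_inf; first by exists `|t - z|; exists z.
move=> _ [y Ey <-]; rewrite leNgt; apply/negP => ty.
exact: (eE y).
Qed.

Lemma set_dist_le E t u : set_dist E t <= set_dist E u + `|t - u|.
Proof.
have [->|/set0P[z Ez]] := eqVneq E set0; first by rewrite !set_dist_set0 add0r.
rewrite -lerBlDr; apply: lb_le_inf; first by exists `|u - z|; exists z.
move=> _ [y Ey <-]; rewrite lerBlDr addrC.
apply: le_trans (ler_distD u t y).
by apply: ge_inf => //; exists y.
Qed.

Lemma set_dist_lipschitz E t u : `|set_dist E t - set_dist E u| <= `|t - u|.
Proof.
have := set_dist_le E t u; have := set_dist_le E u t; rewrite (distrC u) => ? ?.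
by rewrite ler_norml; apply/andP; split; lra.
Qed.

Lemma continuous_set_dist E : continuous (set_dist E).
Proof.
move=> t; apply/cvgrPdist_lt => e e0; apply/nbhs_ballP; exists e => //= u tu.
exact: le_lt_trans (set_dist_lipschitz _ _ _) tu.
Qed.

(** This also covers the empty set, the distance to which is constant. *)
Lemma continuous_set_distV E t : closed E -> ~ E t ->
  (set_dist E u)^-1 @[u --> t] --> (set_dist E t)^-1.
Proof.
move=> cE Et; have [->|/set0P E0] := eqVneq E set0.
  by under eq_fun do rewrite set_dist_set0; rewrite set_dist_set0;
    exact: cvg_cst.
by apply: cvgV; [rewrite gt_eqF// set_dist_gt0|exact: continuous_set_dist].
Qed.

End set_dist.

(** * Closed sets without interior and sequences that leave them *)

Section category.
Context {R : realType}.
Local Notation I01 := (`[0, 1]%classic : set R).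

(** The sets are nowhere dense relatively to [[0, 1]], but the theorem of Baire
    is applied on the line: an open set contained in the closure of a subset of
    [[0, 1]] lies in [[0, 1]], so it is also relatively open. *)
Lemma meager_no_interval (K O : set R) : K `<=` I01 ->
  meager (K : set (subspace I01)) -> open O -> O !=set0 -> ~ (O `<=` K).
Proof.
move=> K01 [G Gnd KG] oO O0 OK.
have GK n : G n `<=` K by rewrite KG; exact: bigcup_sup.
have G01 n : G n `<=` I01 by exact: subset_trans (GK n) K01.
have : forall n, open (~` closure (G n : set R)) /\
  dense (~` closure (G n : set R)).
  move=> n; split; first by rewrite openC; exact: closed_closure.
  move=> O' [x O'x] oO'; apply/set0P/negP => /eqP O'G.
  have O'cl : O' `<=` closure (G n : set R) by rewrite -[X in _ `<=` X]setCK -disjoints_subset.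
  have cl01 : closure (G n : set R) `<=` I01.
    by rewrite (closure_id I01).1//; [exact: closureS|exact: itv_closed].
  suff : (closure (G n : set (subspace I01)))° x by rewrite (Gnd n).
  apply/(nbhs_subspace_ex _ (cl01 _ (O'cl _ O'x))).
  exists (closure (G n : set R)).
    by apply: (filterS O'cl); exact: open_nbhs_nbhs.
  by rewrite closure_subspaceW// -setIA setIid.
move=> /Baire/(_ _ O0 oO)[x [Ox Gx]].
by have := OK _ Ox; rewrite KG => -[n _ Gnx]; apply: (Gx n) => //;
  exact: subset_closure.
Qed.

Lemma fsigma_exhaustion (K : set R) : K `<=` I01 ->
  meager (K : set (subspace I01)) -> Fsigma (K : set (subspace I01)) ->
  exists E : (set R)^nat,
    [/\ forall k, closed (E k), {homo E : j k / (j <= k)%N >-> j `<=` k},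
        K = \bigcup_k E k &
        forall k t e, E k t -> 0 < e ->
          exists u, [/\ 0 <= u <= 1, `|t - u| < e & ~ E k u]].
Proof.
move=> K01 Km [F Fcl KF].
pose E k : set R := \bigcup_(i in `I_k.+1) (F i `&` I01).
have EK k : E k `<=` K.
  by rewrite KF => x [i _ [Fx _]]; exists i.
exists E; split.
- move=> k; apply: closed_bigcup => // i _.
  by rewrite closed_setIS//; exact: itv_closed.
- by move=> j k jk; apply: bigcup_subset => i /= ij; exact: leq_trans jk.
- rewrite eqEsubset; split => [x Kx|x [k _]]; last exact: EK.
  have := Kx; rewrite [in X in X -> _]KF => -[i _ Fx].
  by exists i => //; exists i; [exact: ltnSn|split => //; exact: K01].
move=> k t e Et e0; have /K01/= := EK _ _ Et; rewrite in_itv/= => /andP[t0 t1].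
pose O : set R := `]Num.max 0 (t - e), Num.min 1 (t + e)[%classic.
have O0 : O !=set0.
  exists ((Num.max 0 (t - e) + Num.min 1 (t + e)) / 2).
  rewrite /O/= in_itv/=.
  by case: (ltP 0 (t - e)) => ?; case: (ltP 1 (t + e)) => ?; apply/andP; split;
    lra.
apply: contrapT => H.
apply: (meager_no_interval K01 Km (itv_open _ _) O0) => u.
rewrite /O/= in_itv/= gt_max lt_min => /andP[/andP[u0 u1] /andP[u2 u3]].
apply: (EK k); apply: contrapT => Eu; apply: H; exists u; split => //.
  by apply/andP; split; lra.
by rewrite ltr_norml; apply/andP; split; lra.
Qed.

(** Near [t], the distance to [E] takes all small enough positive values by the
    intermediate value theorem.  Choosing [t_ n] almost as close to [t] as the
    prescribed value of the distance permits gives a single sequence that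
    converges to [t] and takes the prescribed values for all large [n].  The
    value for [n] is the inverse of [n + 1 / 2], at which the wave is exactly
    the [n]-th pulse. *)
Lemma set_dist_sequence (E : set R) (t : R) : closed E -> E t -> 0 <= t <= 1 ->
  (forall e, 0 < e -> exists u, [/\ 0 <= u <= 1, `|t - u| < e & ~ E u]) ->
  exists t_ : R^nat, [/\ forall n, 0 <= t_ n <= 1, t_ @ \oo --> t &
    \forall n \near \oo, (set_dist E (t_ n))^-1 = n%:R + 2^-1].
Proof.
move=> cE Et t01 Ent.
pose P n u := 0 <= u <= 1 /\ set_dist E u = (n%:R + 2^-1)^-1.
have Pnear e : 0 < e -> \forall n \near \oo, exists2 u, P n u & `|t - u| < e.
  move=> /Ent[u [u01 tu Eu]].
  have gu : 0 < set_dist E u by apply: set_dist_gt0 => //; exists t.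
  near=> n.
  have vn : (n%:R + 2^-1)^-1 <= set_dist E u.
    rewrite -[leRHS]invrK lef_pV2 ?posrE ?invr_gt0 ?ltr_wpDl//.
    by rewrite (@le_trans _ _ n%:R) ?lerDl//; near: n; exact: nbhs_infty_ger.
  have v0 : 0 <= (n%:R + 2^-1)^-1 :> R by rewrite invr_ge0 addr_ge0.
  have cg A : {within A, continuous (set_dist E)}.
    by apply: continuous_subspaceT; exact: continuous_set_dist.
  have [tu'|ut'] := leP t u.
    have [|c] := IVT tu' (cg _) (v := (n%:R + 2^-1)^-1).
      by rewrite (set_dist0 Et) min_l ?max_r ?v0 ?vn// ltW.
    rewrite in_itv/= => /andP[tc cu] gc; exists c.
      by split => //; apply/andP; split; lra.
    by move: tu; rewrite !ler0_norm ?subr_le0//; lra.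
  have [|c] := IVT (ltW ut') (cg _) (v := (n%:R + 2^-1)^-1).
    by rewrite (set_dist0 Et) min_r ?max_l ?v0 ?vn// ltW.
  rewrite in_itv/= => /andP[tc cu] gc; exists c.
    by split => //; apply/andP; split; lra.
  by move: tu; rewrite !ger0_norm ?subr_ge0//; lra.
have /choice[t_ Ht] : forall n, exists u, 0 <= u <= 1 /\
    forall v, P n v -> P n u /\ `|t - u| <= `|t - v| + n.+1%:R^-1.
  move=> n; have [[v Pv]|nP] := pselect (exists v, P n v); last first.
    by exists t; split => // v Pv; exfalso; apply: nP; exists v.
  pose D := [set `|t - v| | v in P n].
  have lbD : has_lbound D by exists 0 => _ [? _ <-].
  have hD : has_inf D by split => //; exists `|t - v|; exists v.
  have [|_ [u Pu <-] uD] := inf_adherent _ hD (eps := n.+1%:R^-1) => //.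
  exists u; split; first by case: Pu.
  move=> v' Pv'; split => //; apply: (le_trans (ltW uD)).
  by rewrite lerD2r; apply: ge_inf => //; exists v'.
exists t_; split.
- by move=> n; case: (Ht n).
- apply/cvgrPdist_lt => e e0; have e20 : 0 < e / 2 by rewrite divr_gt0.
  near=> n; have [v Pv tv] : exists2 v, P n v & `|t - v| < e / 2.
    by near: n; exact: Pnear.
  have [_ /(_ _ Pv)[_]] := Ht n; move/le_lt_trans; apply.
  rewrite [e]splitr ltrD//.
  by near: n; exact: (near_infty_natSinv_lt (PosNum e20)).
- near=> n.
  have [v Pv _] : exists2 v, P n v & `|t - v| < 1 by near: n; exact: Pnear.
  by have [_ /(_ _ Pv)[[_ ->] _]] := Ht n; rewrite invrK.
Unshelve. all: by end_near. Qed.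

End category.

(** * The superposition of the waves *)

Lemma lebesgue01E (R : realType) (A : set R) :
  lebesgue01 R A = @lebesgue_measure R (A `&` `[0, 1]%classic).
Proof. by []. Qed.

Section smooth.
Context {R : realType}.

Lemma smooth_on_horner (U : set R) (f : R -> R) (P : {poly R}) : open U ->
  (forall x, U x -> f x = P.[x]) -> smooth_on U f.
Proof.
move=> oU fP.
have near_U (g h : R -> R) x : U x -> (forall y, U y -> g y = h y) ->
    \forall y \near x, g y = h y.
  by move=> Ux gh; apply: (filterS gh); exact: open_nbhs_nbhs.
have dE n x : U x -> derive1n n f x = (P^`(n)).[x].
  elim: n x => [|n IH] x Ux; first exact: fP.
  rewrite derive1nS derivnS derivE !derive1E.
  by apply: near_eq_derive; exact: near_U.
move=> n x Ux; apply: (@near_eq_derivable _ _ _ (horner P^`(n))).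
  by apply: (near_U (horner P^`(n)) (derive1n n f)) => // y Uy; rewrite dE.
exact: derivable_horner.
Qed.

End smooth.

Section wave_continuity.
Context {R : realType}.

(** At a point of [E] the waves nearby are narrow, and at a point off [E] they
    converge uniformly. *)
Lemma wave_cvg_in_measure (E : set R) (t : R) (eta : R) :
  closed E -> 0 < eta <= 1 ->
  \forall u \near t, exists c : R, forall x, 0 <= x <= 1 ->
    ~ `]c - eta, c + eta[%classic x ->
    `|wave (set_dist E u)^-1 x - wave (set_dist E t)^-1 x| <= eta.
Proof.
move=> cE eta01; have /andP[eta0 _] := eta01.
have [Et|Et] := pselect (E t).
  have [Y HY] := wave_small eta01.
  have Y0 : 0 < (`|Y| + 1)^-1 by rewrite invr_gt0 ltr_wpDl.
  have := @continuous_set_dist R E t; rewrite /continuous_at (set_dist0 Et).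
  move=> /cvgrPdist_lt/(_ _ Y0); apply: filterS => u.
  rewrite invr0 sub0r normrN (ger0_norm (set_dist_ge0 _ _)) => gu.
  have [gu0|gu0] := eqVneq (set_dist E u) 0.
    exists 0 => x _ _; rewrite gu0 invr0 subrr normr0; exact: ltW.
  have gu1 : 0 < set_dist E u by rewrite lt_def gu0 set_dist_ge0.
  have gV : 0 < (set_dist E u)^-1 by rewrite invr_gt0.
  have Yg : Y <= (set_dist E u)^-1.
    rewrite (le_trans (ler_norm _))// (@le_trans _ _ (`|Y| + 1)) ?lerDl//.
    by rewrite -[leLHS]invrK lef_pV2 ?posrE// ltW.
  have [c Hc] := HY _ Yg (ltW gV).
  exists c => x x01 xc; rewrite wave0 subr0 ger0_norm; first exact: Hc.
  by have /andP[] := wave01 x (ltW gV).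
have e4 : 0 < eta / 4 by rewrite divr_gt0.
have /cvgrPdist_lt/(_ _ e4) := continuous_set_distV cE Et.
apply: filterS => u tu; exists 0 => x _ _.
rewrite (le_trans (wave_lipschitz _ _ _)) ?invr_ge0 ?set_dist_ge0// distrC; lra.
Qed.

End wave_continuity.

Section superposition.
Context {R : realType} (E : (set R)^nat).
Context (cE : forall k, closed (E k)).
Context (homoE : {homo E : j k / (j <= k)%N >-> j `<=` k}).

(** The inverse of 0 is 0, and the wave at 0 is the zero function: the [k]-th
    wave vanishes when [t] has distance 0 to [E k]. *)
Definition speed k t : R := (set_dist (E k) t)^-1.

Definition superposition t x : R := wsum (fun k => wave (speed k t) x).

Lemma speed_ge0 k t : 0 <= speed k t.
Proof. by rewrite invr_ge0 set_dist_ge0. Qed.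

Let wave_le1 t x k : `|wave (speed k t) x| <= 1.
Proof.
by have /andP[? ?] := wave01 x (speed_ge0 k t); rewrite ger0_norm.
Qed.

Definition partial M t x : R := \sum_(0 <= k < M) weight k * wave (speed k t) x.

Lemma superposition_approx M t x : `|superposition t x - partial M t x| <=
  8^-1 ^+ M / 7.
Proof. exact: wsum_approx. Qed.

Lemma superposition_le t x : `|superposition t x| <= 1 / 7.
Proof.
by have := superposition_approx 0 t x; rewrite /partial big_geq// subr0 expr0.
Qed.

Lemma continuous_wave y : continuous (@wave R y).
Proof.
by move=> x; apply: cvgM; [exact: cvg_cst|exact: continuous_pulse].
Qed.

Lemma measurable_superposition t : measurable_fun setT (superposition t).
Proof.
apply: (@measurable_fun_cvg _ _ _ _ (fun n => partial n t)) => [n|x _].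
  apply: measurable_sum => k; apply: measurable_funM => //.
  by apply: continuous_measurable_fun; exact: continuous_wave.
exact: wsum_cvg.
Qed.

Lemma superposition_stop M t x : E M t -> superposition t x = partial M t x.
Proof.
move=> EMt; apply: lim_near_cst; first exact: norm_hausdorff.
near=> n; have Mn : (M <= n)%N by near: n; exact: nbhs_infty_ge.
rewrite /series/= (@big_cat_nat _ _ _ M)//= [X in _ + X]big_nat_cond.
rewrite [X in _ + X]big1 ?addr0// => k /andP[/andP[Mk _] _].
by rewrite /speed (set_dist0 (homoE Mk EMt)) invr0 wave0 mulr0.
Unshelve. all: by end_near. Qed.

Lemma superposition_smooth M t : E M t -> smooth_on `]0, 1[%classic (superposition t).
Proof.
move=> EMt; pose P : {poly R} := \sum_(0 <= k < M)
  (weight k * amplitude (speed k t)) *: bump (Num.truncn (speed k t)).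
apply: (@smooth_on_horner _ _ _ P); first exact: itv_open.
move=> x /=; rewrite in_itv/= => /andP[x0 x1].
rewrite (superposition_stop _ EMt) horner_sum; apply: eq_bigr => k _.
by rewrite hornerZ -mulrA /wave /pulse clamp_id// !ltW.
Qed.

(** The first [M] waves are estimated by their Lipschitz constants, and the
    others by their total variation, which is at most 2 for each of them. *)
Lemma partial_variation M N t n (u v : 'I_n -> R) :
  (forall i, 0 <= u i /\ u i <= v i /\ v i <= 1) ->
  trivIset setT (fun i => `]u i, v i[%classic) ->
  \sum_(i < n) `|partial (M + N) t (v i) - partial (M + N) t (u i)| <=
    (\sum_(0 <= k < M) weight k * (2 * (Num.truncn (speed k t))%:R)) *
      \sum_(i < n) (v i - u i) + 8^-1 ^+ M * (2 / 7).
Proof.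
move=> uv tuv.
have uv' i : u i <= v i by have [_ []] := uv i.
pose V k := \sum_(i < n) `|wave (speed k t) (v i) - wave (speed k t) (u i)|.
apply: (@le_trans _ _ (\sum_(0 <= k < M + N) weight k * V k)).
  have -> : \sum_(0 <= k < M + N) weight k * V k = \sum_(i < n)
      \sum_(0 <= k < M + N)
        weight k * `|wave (speed k t) (v i) - wave (speed k t) (u i)|.
    by rewrite exchange_big; apply: eq_bigr => k _; rewrite /V mulr_sumr.
  apply: ler_sum => i _.
  rewrite /partial -sumrB (le_trans (ler_norm_sum _ _ _))//.
  apply: ler_sum => k _.
  by rewrite -mulrBr normrM (ger0_norm (weight_ge0 _)).
rewrite (@big_cat_nat _ _ _ M)//= ?leq_addr// lerD//.
  rewrite mulr_suml; apply: ler_sum => k _.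
  rewrite -mulrA ler_wpM2l ?weight_ge0// mulr_sumr.
  apply: ler_sum => i _; have [u0 [_ v1]] := uv i.
  apply: le_trans (wave_space_lipschitz _ _ _) _; first exact: speed_ge0.
  - by rewrite u0 (le_trans (uv' i)).
  - by rewrite v1 (le_trans u0).
  - by rewrite ger0_norm ?subr_ge0.
apply: (@le_trans _ _ (\sum_(M <= k < M + N) weight k * 2)).
  apply: ler_sum => k _; rewrite ler_wpM2l ?weight_ge0//.
  by apply: wave_variation => //; exact: speed_ge0.
have : 0 <= 8^-1 ^+ (M + N) :> R by rewrite exprn_ge0.
by rewrite -mulr_suml weight_sum; lra.
Qed.

Lemma superposition_abs_continuous t : abs_continuous 0 1 (superposition t).
Proof.
move=> e e0.
have [M HM] := @expr_small R 8^-1 e ltac:(lra) e0.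
pose L : R := \sum_(0 <= k < M) weight k * (2 * (Num.truncn (speed k t))%:R).
have L0 : 0 <= L.
  by apply: sumr_ge0 => k _; rewrite mulr_ge0 ?weight_ge0// mulr_ge0.
exists (e / (4 * (L + 1))); first by rewrite divr_gt0// mulr_gt0// ltr_wpDl.
move=> n u v uv tuv uvd.
have en : 0 < e / n.+1%:R by rewrite divr_gt0.
(* The intervals are [n] in number: truncating the series at [M + N] costs at
   most [e / n.+1] on each of them. *)
have [N HN] := @expr_small R 8^-1 _ ltac:(lra) en.
apply: (@le_lt_trans _ _ (\sum_(i < n)
  (`|partial (M + N) t (v i) - partial (M + N) t (u i)| + e / n.+1%:R * (2 / 7)))).
  apply: ler_sum => i _.
  have := superposition_approx (M + N) t (v i);
    have := superposition_approx (M + N) t (u i).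
  have := HN (M + N)%N (leq_addl _ _).
  set q := 8^-1 ^+ _; set d := e / _; set a := partial _ _ _;
    set b := partial _ _ _.
  move=> qd; rewrite !ler_norml => /andP[a1 a2] /andP[b1 b2].
  have := ler_norm (b - a); have := ler_norm (a - b); rewrite (distrC a b).
  by move=> ? ?; apply/andP; split; lra.
rewrite big_split/= sumr_const card_ord -[_ *+ n]mulr_natr.
have nd : e / n.+1%:R * (2 / 7) * n%:R <= e * (2 / 7).
  rewrite mulrAC ler_wpM2r// mulrAC ler_pdivrMr// ler_wpM2l ?(ltW e0)//.
  by rewrite ler_nat.
have := partial_variation M N t uv tuv; rewrite -/L.
have := HM M (leqnn M).
have : L * \sum_(i < n) (v i - u i) <= e / 4.
  apply: (@le_trans _ _ ((L + 1) * (e / (4 * (L + 1))))).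
    apply: ler_pM => //; [|by rewrite lerDl|exact: ltW].
    by apply: sumr_ge0 => i _; rewrite subr_ge0; have [_ []] := uv i.
  rewrite le_eqVlt; apply/orP; left; apply/eqP; field.
  by rewrite gt_eqF// ltr_wpDl.
move: nd; move: (e / n.+1%:R * (2 / 7) * n%:R) => a nd.
move: (L * _) (8^-1 ^+ M) (\sum_(i < n) `|_|) => b q s; lra.
Qed.

(** The exceptional set is the union of those of the first [M] waves, and the
    remainder of the series is small everywhere.  As only the measure of
    [[0, 1]] counts, the complement of [[0, 1]] is added to it. *)
Lemma superposition_cvg_in_measure t (e : R) : 0 < e <= 1 ->
  \forall u \near t, exists B : set R,
    [/\ measurable B, (lebesgue01 R B <= e%:E)%E &
        forall x, ~ B x -> `|superposition t x - superposition u x| <= e].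
Proof.
move=> /andP[e0 e1].
have [M HM] := @expr_small R 8^-1 e ltac:(lra) e0.
pose eta := e / (2 * M.+1%:R).
have M1 : 1 <= M.+1%:R :> R by rewrite ler1n.
have eta0 : 0 < eta by rewrite divr_gt0// mulr_gt0.
have eta1 : eta <= e by rewrite ler_pdivrMr ?mulr_gt0//; nra.
have etaM : eta * 2 * M%:R <= e.
  have eE : eta * (2 * M.+1%:R) = e by rewrite divfK// gt_eqF// mulr_gt0.
  by rewrite -[leRHS]eE -mulrA ler_wpM2l ?(ltW eta0)// ler_wpM2l// ler_nat.
pose P (k : nat) u := exists c : R, forall x, 0 <= x <= 1 ->
  ~ `]c - eta, c + eta[%classic x ->
  `|wave (speed k u) x - wave (speed k t) x| <= eta.
have : \forall u \near t, forall k : 'I_M, P k u.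
  have Pk (k : 'I_M) : \forall u \near t, P k u.
    by apply: wave_cvg_in_measure => //; rewrite eta0 (le_trans eta1).
  exact: (filter_forall _ Pk).
apply: filterS => u Hu.
have /choice[c Hc] : forall k : nat, exists c : R, (k < M)%N ->
    forall x, 0 <= x <= 1 -> ~ `]c - eta, c + eta[%classic x ->
    `|wave (speed k u) x - wave (speed k t) x| <= eta.
  move=> k; have [kM|kM] := ltnP k M; last by exists 0.
  by have [c Hc] := Hu (Ordinal kM); exists c.
pose A k : set R := `]c k - eta, c k + eta[%classic.
pose B0 := \big[setU/set0]_(k < M) A k.
have mB0 : measurable B0 by apply: bigsetU_measurable => k _;
  exact: measurable_itv.
have mI : measurable (`[0, 1]%classic : set R) by exact: measurable_itv.
exists (~` `[0, 1]%classic `|` B0); split.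
- by apply: measurableU => //; exact: measurableC.
- rewrite lebesgue01E setIUl setICl set0U.
  apply: (@le_trans _ _ (lebesgue_measure B0)).
    apply: le_measure; [|by rewrite inE|exact: subIsetl].
    by rewrite inE; exact: measurableI.
  have := @Boole_inequality _ _ _ (@lebesgue_measure R) A M (fun k _ => measurable_itv _).
  move=> /le_trans; apply.
  rewrite (eq_bigr (fun=> (eta * 2)%:E)); last first.
    move=> k _; have ck : c k - eta < c k + eta by lra.
    rewrite /A; apply: etrans (lebesgue_measure_itv _) _; rewrite /= lte_fin ck.
    by rewrite -EFinD; congr EFin; lra.
  by rewrite sumEFin lee_fin sumr_const card_ord -[_ *+ M]mulr_natr.
move=> x /not_orP[/contrapT/=]; rewrite in_itv/= => x01 xB0.
have := superposition_approx M t x; have := superposition_approx M u x.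
have := HM M (leqnn M).
have : `|partial M u x - partial M t x| <= eta / 7.
  rewrite /partial -sumrB (le_trans (ler_norm_sum _ _ _))//.
  rewrite (@le_trans _ _ (\sum_(0 <= k < M) weight k * eta))//.
    rewrite big_nat_cond [leRHS]big_nat_cond; apply: ler_sum => k.
    rewrite andbT => /= kM; rewrite -mulrBr normrM ger0_norm ?weight_ge0//.
    rewrite ler_wpM2l ?weight_ge0//; apply: Hc => // xA; apply: xB0.
    by rewrite /B0 -bigcup_mkord; exists k.
  rewrite -mulr_suml -[M in X in X * _]add0n weight_sum add0n expr0.
  have : 0 <= 8^-1 ^+ M :> R by rewrite exprn_ge0.
  nra.
rewrite !ler_norml => /andP[? ?] ? /andP[? ?] /andP[? ?].
by apply/andP; split; lra.
Qed.

End superposition.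

(** * Oscillation of the superposition *)

Section oscillation.
Context {R : realType} (E : (set R)^nat).
Context (cE : forall k, closed (E k)).

Lemma partial_continuous k t : (forall j, (j < k)%N -> ~ E j t) ->
  forall eta : R, 0 < eta -> \forall u \near t, forall x,
    `|partial E k t x - partial E k u x| <= eta.
Proof.
move=> Et eta eta0.
have e4 : 0 < eta / 4 by rewrite divr_gt0.
have Hj (j : 'I_k) : \forall u \near t, `|speed E j t - speed E j u| < eta / 4.
  have /cvgrPdist_lt := continuous_set_distV (@cE j) (Et j (ltn_ord j)).
  exact.
apply: filterS (filter_forall _ Hj) => u Hu x.
rewrite /partial !big_mkord -sumrB (le_trans (ler_norm_sum _ _ _))//.
apply: (@le_trans _ _ (\sum_(j < k) weight j * eta)).
  apply: ler_sum => j _; rewrite -mulrBr normrM ger0_norm ?weight_ge0//.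
  rewrite ler_wpM2l ?weight_ge0// (le_trans (wave_lipschitz _ _ _)) ?speed_ge0//.
  by have := Hu j; lra.
rewrite -mulr_suml -(big_mkord xpredT weight) -[k in X in X * _]add0n.
rewrite weight_sum add0n expr0.
have : 0 <= 8^-1 ^+ k :> R by rewrite exprn_ge0.
nra.
Qed.

(** In units of the weight of the [k]-th wave, this wave goes below [1 / 4] and
    above [3 / 4] infinitely often.  The earlier waves contribute an error of
    at most [1 / 28] and the later ones one of at most [1 / 7]; so the sums
    differ by at least [1 / 2 - 10 / 28 = 1 / 7] infinitely often, while
    values in a ball of radius [1 / 28] differ by less than [1 / 14]. *)
Lemma superposition_not_cauchy k t (t_ : R^nat) x :
  (forall j, (j < k)%N -> ~ E j t) -> t_ @ \oo --> t ->
  (\forall n \near \oo, (set_dist (E k) (t_ n))^-1 = n%:R + 2^-1) ->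
  0 <= x <= 1 -> ~ cauchy (superposition E (t_ n) x @[n --> \oo]).
Proof.
move=> Et tt distn x01 /cauchyP fc.
have W0 := weight_gt0 k : 0 < weight k :> R.
have W28 : 0 < weight k / 28 :> R by rewrite divr_gt0.
pose L := partial E k t x.
have near_L : \forall n \near \oo,
    `|superposition E (t_ n) x - (L + weight k * pulse n x)| <=
      weight k / 28 + weight k / 7.
  have := tt _ (partial_continuous Et W28); rewrite nbhs_simpl/=.
  apply: filterS2 distn => n gn Ln.
  have := superposition_approx E k.+1 (t_ n) x.
  have -> : partial E k.+1 (t_ n) x =
      partial E k (t_ n) x + weight k * wave (speed E k (t_ n)) x.
    by rewrite /partial big_nat_recr.
  rewrite /speed gn wave_half.
  rewrite -/(weight k); have := Ln x; rewrite -/L.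
  rewrite !ler_norml => /andP[? ?] /andP[? ?]; apply/andP; split; lra.
have [z zc] := fc _ W28.
have [N _ HN] : \forall n \near \oo,
    `|superposition E (t_ n) x - (L + weight k * pulse n x)| <=
      weight k / 28 + weight k / 7 /\
    `|z - superposition E (t_ n) x| < weight k / 28.
  by near=> n; split; near: n; [exact: near_L|exact: zc].
have [n Nn /(ler_wpM2l (ltW W0)) hi] := @bump_high R N x x01.
have [m Nm /(ler_wpM2l (ltW W0)) lo] := @bump_low R N x x01.
have [] := HN _ Nn; have [] := HN _ Nm.
rewrite /pulse !clamp_id// !ler_norml !ltr_norml.
move=> /andP[? ?] /andP[? ?] /andP[? ?] /andP[? ?]; lra.
Unshelve. all: by end_near. Qed.

End oscillation.

(** * Continuity in the space of p-integrable functions *)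

Section Lp.
Context {R : realType}.
Local Notation la := (lebesgue01 R).

Lemma lebesgue01_setT : la setT = 1%E.
Proof. by rewrite lebesgue01E setTI lebesgue_measure_itv/= lte_fin ltr01 oppr0 adde0. Qed.

Lemma lebesgue01_setC0 (K : set R) :
  measurable K -> la K = 1%E -> la (~` K) = 0%E.
Proof.
move=> mK; rewrite !lebesgue01E => K1.
have mI : measurable (`[0, 1]%classic : set R) by exact: measurable_itv.
have I1 : @lebesgue_measure R `[0, 1]%classic = 1%E.
  by rewrite lebesgue_measure_itv/= lte_fin ltr01 oppr0 adde0.
have -> : @lebesgue_measure R (~` K `&` `[0%R, 1%R]%classic) =
    (@lebesgue_measure R `[0%R, 1%R]%classic -
     @lebesgue_measure R (`[0%R, 1%R]%classic `&` K))%E.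
  rewrite setIC -setDE; apply: measureD => //.
  by apply: le_lt_trans (ltry 1); rewrite -I1.
by rewrite I1 setIC K1 subee.
Qed.

(** Since [`|h|] is at most 1, its [p]-th power is at most [`|h|], and hence at
    most [e] plus the indicator of [B]. *)
Lemma integral_pow_le (p : R) (h : R -> R) (B : set R) (e : R) :
  1 <= p -> measurable_fun setT h -> (forall x, `|h x| <= 1) ->
  measurable B -> (la B <= e%:E)%E -> 0 <= e ->
  (forall x, ~ B x -> `|h x| <= e) ->
  (\int[la]_x (`|(EFin \o h) x| `^ p) <= (e + e)%:E)%E.
Proof.
move=> p1 mh h1 mB Be e0 hB.
have p0 : 0 < p by rewrite (lt_le_trans ltr01).
apply: (@le_trans _ _ (\int[la]_x (cst e%:E x + (\1_B x)%:E))%E).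
  apply: ge0_le_integral => //.
  - by move=> x _; exact: poweR_ge0.
  - apply/measurable_EFinP/(@measurableT_comp _ _ _ _ _ _ (@powR R ^~ p)) => //.
    exact: measurableT_comp.
  - apply: emeasurable_funD => //; apply/measurable_EFinP.
    exact: measurable_indic.
  move=> x _ /=; rewrite -EFinD lee_fin.
  have hp : `|h x| `^ p <= `|h x|.
    have [h0|h0] := eqVneq `|h x| 0; first by rewrite h0 powR0// gt_eqF.
    by apply: ge1r_powR => //; rewrite lt_def h0 normr_ge0/=.
  apply: le_trans hp _.
  rewrite indicE; have [/set_mem Bx|/negP Bx] := boolP (x \in B).
    by rewrite (le_trans (h1 x))// lerDr.
  by rewrite addr0 hB// => Bx'; apply: Bx; rewrite inE.
rewrite ge0_integralD//; last first.
  by apply/measurable_EFinP; exact: measurable_indic.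
rewrite integral_cst// lebesgue01_setT mule1 integral_indic// setIT EFinD.
by rewrite leeD2l.
Qed.

End Lp.

Section superposition_Lp.
Context {R : realType} {p : R} {p1 : (1 <= p%:E)%E}.
Local Notation la := (lebesgue01 R).

Let p1' : 1 <= p. Proof. by rewrite -lee_fin. Qed.
Let p0 : 0 < p. Proof. exact: lt_le_trans ltr01 p1'. Qed.

Lemma bounded_Lfun (h : R -> R) : measurable_fun setT h ->
  (forall x, `|h x| <= 1) -> h \in Lfun la p%:E.
Proof.
move=> mh h1; rewrite inE/=; apply/andP; split; rewrite inE//=.
rewrite /finite_norm unlock poweR_lty//.
apply: le_lt_trans (integral_pow_le (B := set0) p1' mh h1 _ _ ler01 _) (ltry _).
- exact: measurable0.
- by rewrite measure0 lee_fin.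
- by move=> x _; exact: h1.
Qed.

Lemma Lp_seminorm_lt (g : calLp la p1) (d : R) : 0 < d ->
  (\int[la]_x (`|(EFin \o g) x| `^ p) < (d `^ p)%:E)%E -> Lp_seminorm g < d.
Proof.
move=> d0 gd; rewrite ltNge; apply/negP => dg.
have := gd;
  rewrite -poweR_Lnorm ?gt_eqF// -(finite_norm_fine (g : LfunType la p1)).
rewrite poweR_EFin lte_fin ltNge => /negP; apply.
by apply: ge0_ler_powR; rewrite ?nnegrE ?(ltW p0) ?(ltW d0)//;
  exact: le_trans (ltW d0) dg.
Qed.

(** For uniformly bounded functions, convergence in measure implies convergence
    in the seminorm. *)
Lemma continuous_calLp (f : R -> calLp la p1) :
  (forall t x, `|f t x| <= 1 / 2) ->
  (forall t e, 0 < e <= 1 -> \forall u \near t, exists B : set R,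
    [/\ measurable B, (la B <= e%:E)%E &
        forall x, ~ B x -> `|f t x - f u x| <= e]) ->
  continuous f.
Proof.
move=> f1 fcvg t; apply/cvg_ballP => d d0.
have dp0 : 0 < d `^ p by exact: powR_gt0.
pose e : R := Num.min 1 (d `^ p / 3).
have e0 : 0 < e by rewrite lt_min ltr01 divr_gt0.
have e1 : e <= 1 by rewrite ge_min lexx.
have ed : e + e < d `^ p.
  have : e <= d `^ p / 3 by rewrite ge_min lexx orbT.
  lra.
apply: filterS (fcvg t e _); last by rewrite e0.
move=> u [B [mB Be fB]].
apply: Lp_seminorm_lt => //.
apply: (@le_lt_trans _ _ (e + e)%:E); last by rewrite lte_fin.
apply: (@integral_pow_le R p _ B) => //; last exact: ltW.
  have mf v : measurable_fun setT (f v : R -> R) by case: (f v) => g [[]].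
  exact: (measurable_funB (mf t) (mf u)).
move=> x; apply: le_trans (ler_normB (f t x) (f u x)) _.
by have := f1 t x; have := f1 u x; lra.
Qed.

End superposition_Lp.

(** * The theorem *)

Theorem theorem2p1 (R : realType) (p : R) (p1 : (1 <= p%:E)%E) (K : set R)
    (K01 : K `<=` `[0, 1])
    (Kmeager : meager (K : set (subspace (`[0, 1] : set R))))
    (KFsigma : Fsigma (K : set (subspace (`[0, 1] : set R)))) :
  let lambda := lebesgue01 R in
  let mu := lebesgue01 R in
  exists f : R -> calLp lambda p1,
    let condii (t : R) := smooth_on `]0, 1[ (f t) in
    let condA (t : R) :=
      exists t_ : R^nat,
        [/\ forall n, t_ n \in `[0, 1],
            t_ n @[n --> \oo] --> t &
            lambda [set x | x \in `[0, 1] /\ cauchy (f (t_ n) x @[n --> \oo])] = 0%E]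
    in
    [/\ {within `[0, 1], continuous f},
        forall t, t \in `[0, 1] -> abs_continuous 0 1 (f t),
        forall t, K t -> condii t,
        forall t, K t -> condA t &
        mu K = 1%E -> {ae mu, forall t, condii t /\ condA t}].
Proof.
move=> la mu.
have [E [cE homoE KE Eint]] := fsigma_exhaustion K01 Kmeager KFsigma.
have fam_le t x : `|superposition E t x| <= 1 / 2.
  by have := superposition_le E t x; lra.
have famL t : superposition E t \in Lfun la p%:E.
  apply: bounded_Lfun => //; first exact: measurable_superposition.
  by move=> x; have := fam_le t x; lra.
exists (fun t => Lfun_Sub p1 (famL t)).
move=> condii condA.
have Kii t : K t -> condii t.
  by rewrite KE => -[k _ Ekt]; exact: (superposition_smooth homoE Ekt).
have KA t : K t -> condA t.
  move=> Kt; have := Kt; rewrite KE => -[k0 _ Ek0t].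
  have exk : exists k, `[< E k t >] by exists k0; exact/asboolP.
  case: (ex_minnP exk) => k /asboolP Ekt kmin.
  have t01 : 0 <= t <= 1 by have := K01 _ Kt; rewrite /= in_itv.
  have [t_ [t_01 tt distn]] :=
    set_dist_sequence (@cE k) Ekt t01 (Eint k t ^~ Ekt).
  exists t_; split => //.
  rewrite [X in la X](_ : _ = set0) ?measure0// -subset0 => x [].
  rewrite in_itv/= => x01.
  apply: (superposition_not_cauchy cE _ tt distn x01) => j jk Ejt.
  by have := kmin j (introT (asboolP _) Ejt); rewrite leqNgt jk.
split => //.
- apply: continuous_subspaceT; apply: continuous_calLp => //.
  by move=> t e e01; exact: superposition_cvg_in_measure.
- by move=> t _; exact: superposition_abs_continuous.
- move=> muK.
  have mK : measurable (K : set (measurableTypeR R)).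
    by rewrite KE; apply: bigcup_measurable => k _; exact: closed_measurable.
  exists (~` K); split; [exact: measurableC|exact: lebesgue01_setC0|].
  by move=> t /= H Kt; apply: H; split; [exact: Kii|exact: KA].
Qed.
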